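(* Let $\alpha$ be an irrational number with Diophantine type $1<\gamma(\alpha)\le+\infty$ and let $R_\alpha:\mathbb{S}^1\to\mathbb{S}^1$, $R_\alpha(x)=x+\alpha\pmod{\mathbb{Z}}$. For each integer $r\ge0$ and each real $\gamma'\ge 0$ with $\gamma'<\gamma(\alpha)$ there exist a sequence of numbers $\delta_j>0$, with $\delta_j\to0$ as $j\to\infty$, and $C^\infty$ diffeomorphisms $T_j:\mathbb{S}^1\to\mathbb{S}^1$ such that, for every $j\in\mathbb{N}$, $\|T_j-R_\alpha\|_{C^r}\le2\delta_j$ and $$\|m-\mu_j\|_W\ge\frac12\,\delta_j^{\frac{1}{\gamma'+1}}$$ for every invariant Borel probability measure $\mu_j$ of $T_j$.
   Context: $\mathbb{S}^1=\mathbb{R}/\mathbb{Z}$ and $m$ is Lebesgue (probability) measure on $\mathbb{S}^1$. For a finite signed Borel measure $\mu$ on $\mathbb{S}^1$, $$\|\mu\|_W:=\sup\left\{\left|\int_{\mathbb{S}^1} g\,d\mu\right| : g:\mathbb{S}^1\to\mathbb{R},\ \mathrm{Lip}(g)\le1,\ \|g\|_\infty\le1\right\},$$ where $\mathrm{Lip}(g)$ is the best Lipschitz constant of $g$ for the circle distance. With $\|\cdot\|_{\mathbb{Z}}$ the distance to the nearest integer, the Diophantine type of an irrational $\alpha$ is $$\gamma(\alpha):=\sup\{\gamma\ge0:\ \liminf_{k\to\infty}k^{\gamma}\|k\alpha\|_{\mathbb{Z}}=0\}\in[0,+\infty].$$ For $T_j$ close to $R_\alpha$, $T_j-R_\alpha$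 is regarded as a real-valued function on $\mathbb{S}^1$ via lifts, and $\|f\|_{C^r}=\max_{0\le i\le r}\sup|f^{(i)}|$. *)

(* Defs.v *)
From HB Require Import structures.
From mathcomp Require Import all_boot all_order all_algebra.
From mathcomp Require Import all_classical all_reals all_analysis.
From mathcomp Require Import measurable_realfun ring_quotient.

Set Implicit Arguments.
Unset Strict Implicit.
Unset Printing Implicit Defensive.

Import Order.TTheory GRing.Theory Num.Theory.
Import numFieldNormedType.Exports.

Local Open Scope classical_set_scope.
Local Open Scope ring_scope.
Local Open Scope quotient_scope.

(* The circle R/Z: the quotient group of R by its integers, with the quotient
   topology and the Borel sigma-algebra of that topology. *)
Section circle.
Variable R : realType.

Definition integers : zmodClosed R :=
  GRing.ZmodClosed.clone R (@Num.int_num_subdef R) _.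

Definition int_quot : Type := Quotient.quot integers.
HB.instance Definition _ := GRing.Zmodule.on int_quot.
HB.instance Definition _ := Quotient.on int_quot.

Definition circle : Type := quotient_topology int_quot.
HB.instance Definition _ := Quotient.on circle.
HB.instance Definition _ := PointedTopological.on circle.
HB.instance Definition _ := GRing.Zmodule.copy circle int_quot.
HB.instance Definition _ := Measurable.copy circle
  (g_sigma_algebraType (@open circle)).

Definition circle_proj (x : R) : circle := \pi_circle x.

Lemma circle_projD : {morph circle_proj : x y / x + y}.
Proof. exact: Quotient.pi_add. Qed.

Lemma circle_proj_eq (x y : R) :
  circle_proj x = circle_proj y <-> x - y \is a Num.int.
Proof.
have -> : (x - y \is a Num.int) = (x == y %[mod int_quot]).
  by rewrite -Quotient.idealrBE.
by split=> [xy|/eqP//]; apply/eqP.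
Qed.

Lemma circle_proj_continuous : continuous circle_proj.
Proof. exact: pi_continuous. Qed.

Definition nint_dist (x : R) : R := inf [set `|x - n%:~R| | n in [set: int]].

(* nint_dist is 1-periodic, so the choice of representative is immaterial. *)
Definition circle_dist (x y : circle) : R := nint_dist (repr (x - y)).

Definition rotation (alpha : R) (x : circle) : circle := x + circle_proj alpha.

End circle.

(* measurableTypeR R, rather than R, is the domain of lebesgue_measure. *)
Lemma measurable_circle_proj (R : realType) :
  @measurable_fun _ _ (measurableTypeR R) (circle R) setT (@circle_proj R).
Proof.
apply: (measurability (@open (circle R))) => // _ [B oB <-].
rewrite setTI; apply: open_measurable.
by move/continuousP : (@circle_proj_continuous R); exact.
Qed.

Section circle_lebesgue.
Variable R : realType.
Local Open Scope ereal_scope.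
Local Notation mu := (@lebesgue_measure R).
Local Notation dom := [set` `[0%R, 1%R[].

(* The image under the projection of Lebesgue measure on [0, 1[. *)
Definition circle_lebesgue (A : set (circle R)) : \bar R :=
  mu (@circle_proj R @^-1` A `&` dom).

Let m_preimage (A : set (circle R)) : measurable A ->
  measurable (@circle_proj R @^-1` A `&` dom).
Proof.
move=> mA; apply: measurableI => //.
by rewrite -[X in measurable X]setTI; exact: measurable_circle_proj.
Qed.

Let circle_lebesgue0 : circle_lebesgue set0 = 0.
Proof. by rewrite /circle_lebesgue preimage_set0 set0I measure0. Qed.

Let circle_lebesgue_ge0 A : 0 <= circle_lebesgue A.
Proof. exact: measure_ge0. Qed.

Let circle_lebesgue_sigma_additive : semi_sigma_additive circle_lebesgue.
Proof.
move=> F mF tF mUF; rewrite /circle_lebesgue preimage_bigcup setI_bigcupl.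
apply: measure_semi_sigma_additive.
- by move=> n; exact: m_preimage.
- apply/trivIsetP => i j _ _ ij; rewrite setIACA -preimage_setI.
  by move/trivIsetP : tF => /(_ _ _ _ _ ij) ->//; rewrite preimage_set0 set0I.
- by rewrite -setI_bigcupl -preimage_bigcup; exact: m_preimage.
Qed.

HB.instance Definition _ := @isMeasure.Build _ (circle R) R circle_lebesgue
  circle_lebesgue0 circle_lebesgue_ge0 circle_lebesgue_sigma_additive.

Let circle_lebesgue_setT : circle_lebesgue [set: circle R] = 1.
Proof.
rewrite /circle_lebesgue preimage_setT setTI lebesgue_measure_itv/=.
by rewrite lte_fin ltr01 oppr0 adde0.
Qed.

HB.instance Definition _ := @Measure_isProbability.Build _ (circle R) R
  circle_lebesgue circle_lebesgue_setT.

End circle_lebesgue.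

Section charge_integral.
Context d (T : measurableType d) (R : realType).
Local Open Scope ereal_scope.

(* Integration against a signed measure, through a Jordan decomposition; see
   charge_integral_sub for the case of a difference of two measures. *)
Definition charge_integral (nu : {charge set T -> \bar R}) (f : T -> \bar R)
    : \bar R :=
  let: exist P exN := cid (Hahn_decomposition nu) in
  let: exist N nuPN := cid exN in
  \int[jordan_pos nuPN]_x f x - \int[jordan_neg nuPN]_x f x.

Definition measure_sub (mu nu : {finite_measure set T -> \bar R})
    : {charge set T -> \bar R} :=
  cadd (charge_of_finite_measure mu) (copp (charge_of_finite_measure nu)).

Lemma charge_integral_sub (mu nu : {finite_measure set T -> \bar R})
    (f : T -> \bar R) :
  mu.-integrable [set: T] f -> nu.-integrable [set: T] f ->
  charge_integral (measure_sub mu nu) f = \int[mu]_x f x - \int[nu]_x f x.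
Proof.
move=> fmu fnu; rewrite /charge_integral.
case: cid => P exN; case: cid => N nuPN.
have [[mP posP] [mN negN] _ _] := nuPN.
pose jp : {finite_measure set T -> \bar R} := jordan_pos nuPN.
pose jn : {finite_measure set T -> \bar R} := jordan_neg nuPN.
change (\int[jp]_x f x - \int[jn]_x f x = \int[mu]_x f x - \int[nu]_x f x).
have subE A : measurable A -> measure_sub mu nu A = mu A - nu A by [].
have jpE A : measurable A -> jp A = mu (A `&` P) - nu (A `&` P).
  by move=> mA; rewrite [LHS]jordan_posE cjordan_posE /crestr0 mem_set.
have jnE A : measurable A -> jn A = nu (A `&` N) - mu (A `&` N).
  move=> mA; have mAN : measurable (A `&` N) by exact: measurableI.
  rewrite [LHS]jordan_negE cjordan_negE /crestr0 mem_set// /crestr subE//.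
  by rewrite fin_num_oppeB ?fin_num_measure// addeC.
have le_jp A : measurable A -> jp A <= mu A.
  move=> mA; rewrite jpE// leeBlDr ?fin_num_measure//; last exact: measurableI.
  apply: (@le_trans _ _ (mu A)); last by rewrite leeDl.
  by rewrite le_measure// inE//; exact: measurableI.
have le_jn A : measurable A -> jn A <= nu A.
  move=> mA; rewrite jnE// leeBlDr ?fin_num_measure//; last exact: measurableI.
  apply: (@le_trans _ _ (nu A)); last by rewrite leeDl.
  by rewrite le_measure// inE//; exact: measurableI.
have dominated (m1 m2 : {measure set T -> \bar R}) :
    (forall A, measurable A -> m1 A <= m2 A) ->
    m2.-integrable [set: T] f -> m1.-integrable [set: T] f.
  move=> m12 /integrableP[mf f2]; apply/integrableP; split => //.
  apply: le_lt_trans f2; apply: ge0_le_measure_integral => //.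
  exact: measurableT_comp.
have fjp := dominated _ _ le_jp fmu.
have fjn := dominated _ _ le_jn fnu.
have eqm A : measurable A -> measure_add jp nu A = measure_add jn mu A.
  move=> mA; rewrite !measure_addE.
  have := jordan_decomp nuPN mA.
  rewrite subE// /cadd/= cscaleN1.
  change (mu A - nu A = jp A - jn A -> jp A + nu A = jn A + mu A) => e.
  have -> : mu A = jp A - jn A + nu A by rewrite -e subeK// fin_num_measure.
  by rewrite addeA [jn A + _]addeC subeK// fin_num_measure.
have : \int[measure_add jp nu]_x f x = \int[measure_add jn mu]_x f x.
  by apply: eq_measure_integral => A mA _; exact: eqm.
rewrite !integral_measure_add// => e.
have fin (m : {measure set T -> \bar R}) :
    m.-integrable [set: T] f -> \int[m]_x f x \is a fin_num.
  exact: integrable_fin_num.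
move: e (fin _ fmu) (fin _ fnu) (fin _ fjp) (fin _ fjn).
move: (\int[mu]_x f x) (\int[nu]_x f x) (\int[jp]_x f x) (\int[jn]_x f x).
move=> [a| |] [b| |] [c| |] [e| |]//= + _ _ _ _.
rewrite -!EFinD => -[ceq]; congr EFin.
by apply/eqP; rewrite subr_eq addrAC -subr_eq opprK ceq addrC.
Qed.

End charge_integral.

Section distances.
Context (R : realType).
Implicit Types (g f : circle R -> R) (T S : circle R -> circle R).

(* The best Lipschitz constant for the circle distance, +oo if there is none. *)
Definition lip_const g : \bar R :=
  ereal_inf [set L%:E | L in [set L : R | 0 <= L /\
    forall x y, `|g x - g y| <= L * circle_dist x y]].

Definition sup_norm (X : Type) (h : X -> R) : \bar R :=
  ereal_sup [set `|h x|%:E | x in [set: X]].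

Definition W_norm (mu : {charge set (circle R) -> \bar R}) : \bar R :=
  ereal_sup [set `|charge_integral mu (EFin \o g)|%E | g in
    [set g : circle R -> R | (lip_const g <= 1)%E /\ (sup_norm g <= 1)%E]].

Definition diophantine_type (alpha : R) : \bar R :=
  ereal_sup [set c%:E | c in [set c : R | 0 <= c /\
    limn_einf (fun k : nat => (k%:R `^ c * nint_dist (k%:R * alpha))%:E)
      = 0%E]].

Definition is_lift (F : R -> R) T :=
  continuous F /\ forall x, T (circle_proj x) = circle_proj (F x).

Definition smooth (F : R -> R) :=
  forall (n : nat) (x : R), derivable (derive1n n F) x 1.

Definition smooth_circle_map T := exists2 F, is_lift F T & smooth F.

Definition smooth_diffeo T :=
  smooth_circle_map T /\
  exists S, [/\ cancel T S, cancel S T & smooth_circle_map S].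

(* f is T - S read as a real-valued function through lifts of T and S; f is
   determined by T and S up to an additive integer constant. *)
Definition lift_difference T S f :=
  exists F G, [/\ is_lift F T, is_lift G S &
    forall x, f (circle_proj x) = F x - G x].

(* Derivatives of f are those of the associated 1-periodic function. *)
Definition Cr_norm (r : nat) f : \bar R :=
  \big[maxe/-oo%E]_(i < r.+1) sup_norm (derive1n i (f \o @circle_proj R)).

Definition invariant_measure T (mu : {measure set (circle R) -> \bar R}) :=
  forall A, measurable A -> mu (T @^-1` A) = mu A.

End distances.

(* Main.v *)
(* Since gamma' is less than the type of alpha, there are arbitrarily large k
   and integers p with |alpha - p/k| <= delta := (4 pi k)^-(gamma' + 1).  Perturb
   R_(p/k), rather than R_alpha, to T(x) = x + p/k - e sin(2 pi k x) with e tiny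
   compared to delta.  The function cos(2 pi k x) does not decrease along T, and
   grows by at least a multiple of sin^2(2 pi k x); hence every T-invariant
   probability measure integrates sin^2(2 pi k x) to zero.  The 1-Lipschitz
   function sin^2(2 pi k x)/(4 pi k) has Lebesgue integral 1/(8 pi k), which is
   exactly delta^(1/(gamma' + 1))/2. *)
Require Import Defs.
From mathcomp Require Import all_boot all_order all_algebra.
From mathcomp Require Import all_classical all_reals all_analysis.
From mathcomp Require Import measurable_realfun ring lra.
Import Order.TTheory GRing.Theory Num.Theory.
Import numFieldNormedType.Exports.
Local Open Scope classical_set_scope.
Local Open Scope ring_scope.

Set Implicit Arguments.
Unset Strict Implicit.
Unset Printing Implicit Defensive.

(** * Differentiability of finite order on the real line *)

Section real_calculus.
Variable R : realType.
Implicit Types (f g F G : R -> R) (n : nat) (x y : R).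

(** Cutting [smooth] down to a finite order lets closure properties be proved by induction on the
    order; order 0 demands nothing. *)
Definition n_derivable n f := forall m x, (m < n)%N -> derivable (derive1n m f) x 1.

Lemma smoothP f : smooth f <-> forall n, n_derivable n f.
Proof. by split=> [sf n m x _|sf n x]; [exact: sf | exact: (sf n.+1)]. Qed.

Lemma n_derivable0 f : n_derivable 0 f.
Proof. by move=> m x; rewrite ltn0. Qed.

Lemma n_derivableS n f :
  n_derivable n.+1 f <-> (forall x, derivable f x 1) /\ n_derivable n (derive1 f).
Proof.
split=> [df|[df df'] [|m] x mn]; last by rewrite derive1Sn; exact: df'.
- split=> [x|m x mn]; first exact: (df 0%N).
  by rewrite -derive1Sn; exact: df.
- exact: df.
Qed.

Lemma n_derivableW m n f : (m <= n)%N -> n_derivable n f -> n_derivable m f.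
Proof. by move=> mn df i x im; apply: df; exact: leq_trans mn. Qed.

(** The inductive step of the closure properties below: an order is gained by exhibiting the
    derivative explicitly. *)
Lemma is_derive_n_derivableS n f g :
  (forall x, is_derive x 1 f (g x)) -> n_derivable n g -> n_derivable n.+1 f.
Proof.
move=> fg dg; apply/n_derivableS; split=> [x|]; first by case: (fg x).
suff -> : derive1 f = g by [].
by apply/funext => x; rewrite derive1E; apply: derive_val.
Qed.

Lemma n_derivable_is_derive n f : n_derivable n.+1 f ->
  (forall x, is_derive x 1 f (derive1 f x)) /\ n_derivable n (derive1 f).
Proof.
case/n_derivableS=> df df'; split=> [x|]; last exact: df'.
by rewrite derive1E; exact: derivableP.
Qed.

Lemma n_derivableD n f g :
  n_derivable n f -> n_derivable n g -> n_derivable n (f + g).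
Proof.
elim: n f g => [|n IH] f g df dg; first exact: n_derivable0.
have [f' nf'] := n_derivable_is_derive df.
have [g' ng'] := n_derivable_is_derive dg.
exact: is_derive_n_derivableS (IH _ _ nf' ng').
Qed.

Lemma n_derivableM n f g :
  n_derivable n f -> n_derivable n g -> n_derivable n (f * g).
Proof.
elim: n f g => [|n IH] f g df dg; first exact: n_derivable0.
have [f' nf'] := n_derivable_is_derive df.
have [g' ng'] := n_derivable_is_derive dg.
have nf := n_derivableW (leqnSn n) df; have ng := n_derivableW (leqnSn n) dg.
have dfg := n_derivableD (IH _ _ nf ng') (IH _ _ ng nf').
exact: is_derive_n_derivableS dfg.
Qed.

Lemma n_derivable_comp n f g :
  n_derivable n f -> n_derivable n g -> n_derivable n (f \o g).
Proof.
elim: n f g => [|n IH] f g df dg; first exact: n_derivable0.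
have [f' nf'] := n_derivable_is_derive df.
have [g' ng'] := n_derivable_is_derive dg.
have ng := n_derivableW (leqnSn n) dg.
exact: is_derive_n_derivableS (n_derivableM (IH _ _ nf' ng) ng').
Qed.

Lemma n_derivable_cst n (c : R) : n_derivable n (cst c).
Proof.
elim: n c => [|n IH] c; first exact: n_derivable0.
exact: is_derive_n_derivableS (IH 0).
Qed.

Lemma n_derivable_id n : n_derivable n (@id R).
Proof.
case: n => [|n]; first exact: n_derivable0.
exact: is_derive_n_derivableS (@n_derivable_cst n 1).
Qed.

Lemma n_derivableV n f : (forall x, f x != 0) ->
  n_derivable n f -> n_derivable n (fun x => (f x)^-1).
Proof.
move=> f0; elim: n => [|n IH] df; first exact: n_derivable0.
have [f' nf'] := n_derivable_is_derive df.
have nV := IH (n_derivableW (leqnSn n) df).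
have dV := n_derivableM (@n_derivable_cst n (-1))
  (n_derivableM (n_derivableM nV nV) nf').
apply: is_derive_n_derivableS dV => x.
apply: (is_derive_eq (is_deriveV (f0 x) (f' x))).
rewrite [RHS](_ : _ = -1 * ((f x)^-1 * (f x)^-1 * derive1 f x))//.
by rewrite mulN1r scaleNr -exprVn expr2.
Qed.

(** Cosine is a translate of sine, so the induction closes on sine alone. *)
Lemma n_derivable_sin n : n_derivable n (@sin R).
Proof.
elim: n => [|n IH]; first exact: n_derivable0.
suff dcos : n_derivable n (@cos R) by exact: is_derive_n_derivableS dcos.
have -> : @cos R = @sin R \o (@id R + cst (pi / 2)).
  by apply/funext => x /=; rewrite -sinDpihalf.
apply: n_derivable_comp IH _.
by apply: n_derivableD; [exact: n_derivable_id|exact: n_derivable_cst].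
Qed.

(** Bootstrapping on [G' = 1 / (F' \o G)]: if [G] and [F'] are differentiable to order [n], so is
    [G'], and [G] gains one order. *)
Lemma is_derive_n_derivable_inverse n F G F' :
  cancel F G -> cancel G F -> continuous F -> (forall x, F' x != 0) ->
  (forall x, is_derive x 1 F (F' x)) -> n_derivable n F' -> n_derivable n G.
Proof.
move=> FK GK cF F'0 dF; elim: n => [|n IH] nF'; first exact: n_derivable0.
have nn := n_derivableW (leqnSn n) nF'.
have dG := n_derivable_comp (n_derivableV F'0 nn) (IH nn).
apply: is_derive_n_derivableS dG => x.
have FKn : {near G x, cancel F G} by exact: (filterS (fun y _ => FK y) filterT).
have cFn : {near G x, continuous F} by exact: (filterS (fun y _ => cF y) filterT).
by have := is_derive_inverse FKn cFn (dF _) (F'0 _); rewrite GK.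
Qed.

Lemma is_derive_continuous f (f' : R -> R) :
  (forall x, is_derive x 1 f (f' x)) -> continuous f.
Proof.
by move=> df z; apply/differentiable_continuous/derivable1_diffP; case: (df z).
Qed.

End real_calculus.

(** * Mean value estimates and derivatives of trigonometric functions *)

Section trigonometric.
Variable R : realType.
Implicit Types (a b c e u w x y : R).

(** The location of [c] is recorded as a distance to [a], which makes sense for endpoints in either
    order. *)
Lemma MVT_between (f f' : R -> R) a b : (forall x, is_derive x 1 f (f' x)) ->
  exists2 c, `|c - a| <= `|b - a| & f b - f a = f' c * (b - a).
Proof.
move=> df; have cf := continuous_subspaceT (is_derive_continuous df).
have [ab|/ltW ba] := leP a b.
  have [c] := MVT_segment ab (fun z _ => df z) (cf _).
  rewrite in_itv/= => /andP[ac cb] ->; exists c => //.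
  by rewrite !ger0_norm ?subr_ge0// lerD2r.
have [c] := MVT_segment ba (fun z _ => df z) (cf _).
rewrite in_itv/= => /andP[bc ca] fab; exists c.
  by rewrite !ler0_norm ?subr_le0// lerN2 lerD2r.
by rewrite -[LHS]opprB fab -mulrN opprB.
Qed.

Lemma lipschitz_is_derive (f f' : R -> R) :
  (forall x, is_derive x 1 f (f' x)) -> (forall x, `|f' x| <= 1) ->
  forall x y, `|f x - f y| <= `|x - y|.
Proof.
move=> df f'1 x y; have [c _ ->] := MVT_between y x df.
by rewrite normrM ler_piMl.
Qed.

Lemma sin_lipschitz x y : `|sin x - sin y| <= `|x - y|.
Proof. by apply: (@lipschitz_is_derive _ (@cos R)) => z; exact: cos_max. Qed.

Lemma sinD2pi_int x (m : int) : sin (x + m%:~R * (pi *+ 2)) = sin x.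
Proof.
have h (n : nat) y : sin (y + n%:R * (pi *+ 2)) = sin y.
  by rewrite mulr_natl; exact: (periodicn (@sinD2pi R)).
case: m => n; first exact: h.
by rewrite NegzE mulrNz mulNr -[LHS](h n.+1) subrK.
Qed.

Lemma cosD2pi_int x (m : int) : cos (x + m%:~R * (pi *+ 2)) = cos x.
Proof. by rewrite -!sinDpihalf addrAC sinD2pi_int. Qed.

(** By the mean value theorem the increment of [cos] is [e * sin u * sin c] with [c] within
    [|e * sin u|] of [u]. Replacing [sin c] by [sin u] costs at most [(e * sin u) ^+ 2], since [sin]
    is 1-Lipschitz. *)
Lemma cos_flow_ge e u :
  cos u + (e - e ^+ 2) * sin u ^+ 2 <= cos (u - e * sin u).
Proof.
have [c cu] := @MVT_between (@cos R) (fun x => - sin x) u (u - e * sin u)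
  (fun x => is_derive_cos x).
rewrite addrAC subrr add0r normrN in cu *.
move/eqP; rewrite subr_eq => /eqP ->.
rewrite mulrNN addrC lerD2r mulrBl lerBlDr.
rewrite (_ : e * sin u ^+ 2 = sin u * (e * sin u)); last by ring.
rewrite -lerBlDl -mulrBl (le_trans (ler_norm _))// normrM.
rewrite (_ : e ^+ 2 * sin u ^+ 2 = `|e * sin u| * `|e * sin u|); last first.
  by rewrite -normrM -expr2 ger0_norm ?sqr_ge0// exprMn.
by rewrite ler_wpM2r// (le_trans (sin_lipschitz _ _))// distrC.
Qed.

(** The derivative is written, with its summand 0, as a member of the same family with coefficients
    [0], [- (b * w)], [a * w], so that it can be iterated. *)
Lemma is_derive_trig a b c w x :
  is_derive x 1 (fun y => c + a * sin (w * y) + b * cos (w * y))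
                (0 + - (b * w) * sin (w * x) + a * w * cos (w * x)).
Proof.
have dw : is_derive x 1 (fun y => w * y) w.
  by apply: is_derive_eq; rewrite [LHS]mulr1.
have ds : is_derive x 1 (fun y => sin (w * y)) (cos (w * x) * w).
  exact: (@is_derive1_comp R (@sin R)).
have dc : is_derive x 1 (fun y => cos (w * y)) (- sin (w * x) * w).
  exact: (@is_derive1_comp R (@cos R)).
by apply: is_derive_eq; rewrite /GRing.scale/=; ring.
Qed.

(** Each differentiation kills the constant and multiplies [|a| + |b|] by [w]; hence the induction
    runs over all coefficients at once. *)
Lemma derive1n_trig_le a b c w i x : 0 <= w ->
  `|derive1n i (fun y => c + a * sin (w * y) + b * cos (w * y)) x|
    <= `|c| + w ^+ i * (`|a| + `|b|).
Proof.
move=> w0; elim: i a b c => [|i IH] a b c.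
  rewrite derive1n0 expr0 mul1r.
  rewrite (le_trans (ler_normD _ _))// addrA lerD//.
    by rewrite (le_trans (ler_normD _ _))// lerD// normrM ler_piMr// sin_max.
  by rewrite normrM ler_piMr// cos_max.
rewrite derive1Sn.
have -> : derive1 (fun y => c + a * sin (w * y) + b * cos (w * y)) =
    (fun y => 0 + - (b * w) * sin (w * y) + a * w * cos (w * y)).
  by apply/funext => y; rewrite derive1E; apply: derive_val; exact: is_derive_trig.
apply: (le_trans (IH _ _ _)).
rewrite normr0 add0r normrN !normrM (ger0_norm w0) exprS.
rewrite (_ : _ * (_ + _) = w * w ^+ i * (`|a| + `|b|)); last by ring.
by rewrite lerDr.
Qed.

End trigonometric.

(** * Circle maps and functions induced from the real line *)

Section circle_maps.
Variable R : realType.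
Implicit Types (F G : R -> R) (T : circle R -> circle R) (x y : R).

Definition int_equivariant F := forall x (n : int), F (x + n%:~R) = F x + n%:~R.

(** Meaningful for an equivariant [F], a lift of degree one; only then is the choice made by [repr]
    immaterial. *)
Definition circle_map F (z : circle R) : circle R := circle_proj (F (repr z)).

Lemma circle_projK (z : circle R) : circle_proj (repr z) = z.
Proof. exact: reprK. Qed.

Lemma repr_circle_proj x : exists n : int, repr (circle_proj x) = x + n%:~R.
Proof.
have /circle_proj_eq/intrP[n xn] := circle_projK (circle_proj x).
by exists n; rewrite -xn addrC subrK.
Qed.

Lemma circle_projDint x (n : int) : circle_proj (x + n%:~R) = circle_proj x.
Proof. by apply/circle_proj_eq; rewrite addrAC subrr add0r intr_int. Qed.

Lemma circle_mapE F x : int_equivariant F ->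
  circle_map F (circle_proj x) = circle_proj (F x).
Proof.
move=> iF; rewrite /circle_map; have [n ->] := repr_circle_proj x.
by rewrite iF circle_projDint.
Qed.

Lemma is_lift_circle_map F : int_equivariant F -> continuous F ->
  is_lift F (circle_map F).
Proof. by move=> iF cF; split=> // x; exact: circle_mapE. Qed.

Lemma circle_map_can F G : int_equivariant G -> cancel F G ->
  cancel (circle_map F) (circle_map G).
Proof. by move=> iG FK z; rewrite circle_mapE// FK circle_projK. Qed.

Lemma smooth_diffeo_circle_map F G : int_equivariant F ->
  cancel F G -> cancel G F -> continuous F -> continuous G ->
  smooth F -> smooth G -> smooth_diffeo (circle_map F).
Proof.
move=> iF FK GK cF cG sF sG.
have iG : int_equivariant G.
  by move=> x n; apply: (can_inj FK); rewrite iF !GK.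
split; first by exists F => //; exact: is_lift_circle_map.
exists (circle_map G); split; [exact: circle_map_can..|].
by exists G => //; exact: is_lift_circle_map.
Qed.

(** The universal property of the quotient topology: a set is open when its preimage under the
    projection is. *)
Lemma circle_continuousP (U : topologicalType) (f : circle R -> U) :
  continuous (f \o @circle_proj R) -> continuous f.
Proof. by move=> /continuousP cf; apply/continuousP => A /cf. Qed.

Lemma continuous_circle_map F : int_equivariant F -> continuous F ->
  continuous (circle_map F).
Proof.
move=> iF cF; apply: circle_continuousP.
have -> : circle_map F \o @circle_proj R = @circle_proj R \o F.
  by apply/funext => x /=; exact: circle_mapE.
move=> x; apply: continuous_comp; first exact: cF.
exact: circle_proj_continuous.
Qed.

Lemma measurable_circle_map F : int_equivariant F -> continuous F ->
  measurable_fun [set: circle R] (circle_map F).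
Proof.
move=> iF cF; apply: (measurability (@open (circle R))) => // _ [B oB <-].
rewrite setTI; apply: sub_sigma_algebra.
by have /continuousP := continuous_circle_map iF cF; exact.
Qed.

Lemma continuous_circle_measurable (f : circle R -> R) :
  continuous f -> measurable_fun [set: circle R] f.
Proof.
move=> /continuousP cf.
apply: (measurability _ (RGenOpens.measurableE R)) => _ [_ [a [b ->]] <-].
by rewrite setTI; apply: sub_sigma_algebra; apply: cf; exact: interval_open.
Qed.

(** The circle distance is an infimum over integers [n]. For each [n], periodicity allows [repr y]
    to be translated so that the difference of the two arguments becomes [repr (x - y) - n]. *)
Lemma circle_fun_lipschitz (g : R -> R) :
  (forall x (n : int), g (x + n%:~R) = g x) ->
  (forall x y, `|g x - g y| <= `|x - y|) ->
  (lip_const (fun z : circle R => g (repr z)) <= 1)%E.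
Proof.
move=> gn gL; apply: ereal_inf_lbound; exists 1 => //=; split=> // x y.
rewrite mul1r; apply: lb_le_inf; first by exists `|repr (x - y) - 0%:~R|; exists 0.
move=> _ [n _ <-].
have [m xy] : exists m : int, repr (x - y) = repr x - repr y + m%:~R.
  have -> : x - y = circle_proj (repr x - repr y).
    apply: (canLR (addrK y)).
    by rewrite -{2}[y]circle_projK -circle_projD subrK circle_projK.
  exact: repr_circle_proj.
rewrite -(gn (repr y) (n - m)) (le_trans (gL _ _))//.
by rewrite xy intrB opprD addrA opprB addrA addrAC.
Qed.

(** Surjectivity is the intermediate value theorem on [[y - M, y + M]], whose endpoints are mapped
    to either side of [y]; injectivity is strict monotonicity. *)
Lemma bounded_displacement_can F M : continuous F ->
  {homo F : x y / x < y} -> (forall x, `|F x - x| <= M) ->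
  exists G, cancel F G /\ cancel G F.
Proof.
move=> cF mF FM.
have surj y : exists x, F x = y.
  have M0 : 0 <= M by exact: le_trans (FM 0).
  have ab : y - M <= y + M by lra.
  have cFab := continuous_subspaceT cF.
  have yab : Num.min (F (y - M)) (F (y + M)) <= y
      <= Num.max (F (y - M)) (F (y + M)).
    have := FM (y - M); have := FM (y + M).
    rewrite !ler_norml => /andP[? ?] /andP[? ?].
    by rewrite ge_min le_max; apply/andP; split; apply/orP; [left|right]; lra.
  by have [c _ <-] := IVT ab (cFab _) yab; exists c.
have injF : injective F.
  by move=> x y Fxy; case: (ltgtP x y) => // /mF; rewrite Fxy ltxx.
exists (fun y => projT1 (cid (surj y))); split=> [x|y]; last by case: cid.
by apply: injF; case: cid.
Qed.

End circle_maps.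

(** * Integration on the circle *)

Section circle_integration.
Variable R : realType.
Local Open Scope ereal_scope.
Implicit Types (f h : circle R -> R).

Lemma bounded_integrable d (X : measurableType d) (mu : probability X R)
    (f : X -> R) (M : R) :
  measurable_fun [set: X] f -> (forall x, `|f x| <= M)%R ->
  mu.-integrable [set: X] (EFin \o f).
Proof.
move=> mf fM; apply: measurable_bounded_integrable => //.
  exact: le_lt_trans (probability_le1 mu measurableT) (ltry _).
exists M; split; first exact: num_real.
by move=> y My x _ /=; exact: le_trans (fM x) (ltW My).
Qed.

Lemma integral_invariant (T : circle R -> circle R) (mu : probability (circle R) R)
    (h : circle R -> R) (M : R) :
  measurable_fun [set: circle R] T -> invariant_measure T mu ->
  measurable_fun [set: circle R] h -> (forall x, `|h x| <= M)%R ->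
  \int[mu]_x (h (T x))%:E = \int[mu]_x (h x)%:E.
Proof.
move=> mT iT mh hM.
have mhT : measurable_fun [set: circle R] (h \o T) by exact: measurableT_comp.
have ihT := bounded_integrable mu mhT (fun x => hM (T x)).
have mh' : measurable_fun [set: circle R] (EFin \o h) by exact: measurableT_comp.
have := @integral_pushforward _ _ _ _ _ T mT mu setT (EFin \o h).
rewrite preimage_setT => <- //.
apply: eq_measure_integral => A mA _; rewrite /pushforward; exact: iT.
Qed.

(** The measure on the circle is the pushforward of Lebesgue measure restricted to [[0, 1[]. The
    null endpoint 1 is added to obtain the form required by the fundamental theorem of calculus. *)
Lemma integral_circle_lebesgue (h : circle R -> R) :
  measurable_fun [set: circle R] h -> (forall x, 0 <= h x)%R ->
  \int[@circle_lebesgue R]_z (h z)%:E =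
  \int[@lebesgue_measure R]_(x in `[0%R, 1%R]) (h (circle_proj x))%:E.
Proof.
move=> mh h0.
have mD : measurable (`[0%R, 1%R[%classic : set (measurableTypeR R)) by [].
pose nu := mrestr (@lebesgue_measure R) mD.
have mp := @measurable_circle_proj R.
have mhp : measurable_fun [set: measurableTypeR R] (EFin \o (h \o @circle_proj R)).
  apply: measurableT_comp => //; exact: measurableT_comp.
transitivity (\int[pushforward nu (@circle_proj R)]_z (EFin \o h) z).
  by apply: eq_measure_integral => A mA _.
rewrite ge0_integral_pushforward//=; last 2 first.
  by apply: measurableT_comp.
  by move=> z _; rewrite lee_fin.
rewrite preimage_setT.
(* The restricted measure [nu] gives no mass to the complement of [[0, 1[], so the domain shrinks to
   that interval. *)
rewrite (ge0_negligible_integral (measurableC mD))//=; last 2 first.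
  by move=> z _; rewrite lee_fin.
  by rewrite /nu/= /mrestr setICl measure0.
rewrite setDE setCK setTI.
rewrite -integral_itv_bndo_bndc; last exact: measurable_funTS.
apply: eq_measure_integral => A mA AD.
by rewrite /nu/= /mrestr setIidl.
Qed.

End circle_integration.

(** * Rational approximations from the Diophantine type *)

Section diophantine.
Variable R : realType.
Implicit Types (alpha c eta x : R).

(** The lower limit is the supremum of the tail infima, so the infimum of the tail from [N] is
    already below [eta]. *)
Lemma limn_einf_lt (u : (\bar R)^nat) (eta : \bar R) (N : nat) :
  (limn_einf u < eta)%E -> exists2 k, (N <= k)%N & (u k < eta)%E.
Proof.
rewrite limn_einf_lim => ueta.
have /ereal_inf_lt[_ [k /= Nk <-] uk] : (einfs u N < eta)%E.
  apply: le_lt_trans ueta.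
  have -> := cvg_lim (@ereal_hausdorff R) (@cvg_einfs_sup R u).
  by apply: ereal_sup_ubound; exists N.
by exists k.
Qed.

Lemma nint_dist_lt x eta : nint_dist x < eta -> exists p : int, `|x - p%:~R| < eta.
Proof.
have nZ : [set `|x - n%:~R| | n in [set: int]] !=set0.
  by exists `|x - 0%:~R|; exists 0.
by move=> /(inf_lt nZ)[_ [p _ <-]]; exists p.
Qed.

Lemma nint_dist_ge0 x : 0 <= nint_dist x.
Proof.
by apply: lb_le_inf; [exists `|x - 0%:~R|; exists 0|move=> _ [p _ <-]].
Qed.

(** The supremum provides an exponent [d > c] with lower limit zero, and [k ^ c <= k ^ d] for
    [k >= 1] transfers the smallness to [c]. *)
Lemma diophantine_type_approx alpha c eta (N : nat) :
  0 <= c -> (c%:E < diophantine_type alpha)%E -> 0 < eta ->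
  exists (k : nat) (p : int),
    [/\ (N <= k)%N, (0 < k)%N & k%:R `^ c * `|k%:R * alpha - p%:~R| < eta].
Proof.
move=> c0 /ereal_sup_gt[_ [d [d0 dlim] <-]].
rewrite lte_fin => cd eta0.
have : (limn_einf (fun k : nat => (k%:R `^ d * nint_dist (k%:R * alpha))%:E)
   < eta%:E)%E by rewrite dlim lte_fin.
(* The index [maxn N 1] excludes [k = 0], where powers are not monotone in the exponent. *)
move=> /(@limn_einf_lt _ _ (maxn N 1))[k]; rewrite geq_max => /andP[Nk k0].
rewrite lte_fin => kd.
have k1 : 1 <= k%:R :> R by rewrite ler1n.
have kc0 : 0 < k%:R `^ c :> R by rewrite powR_gt0// (lt_le_trans ltr01).
have : nint_dist (k%:R * alpha) < eta / k%:R `^ c.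
  rewrite ltr_pdivlMr// mulrC; apply: le_lt_trans kd.
  by rewrite ler_wpM2r ?nint_dist_ge0// ler_powR// ltW.
move=> /nint_dist_lt[p]; rewrite ltr_pdivlMr// mulrC => kp.
by exists k, p.
Qed.

End diophantine.

(** * The perturbed rational rotation and its invariant measures *)

Section perturbed_rotation.
Variables (R : realType) (k : nat) (p : int) (e alpha : R).
Hypothesis k_gt0 : (0 < k)%N.
Let w : R := k%:R * (pi *+ 2).
Let b : R := p%:~R / k%:R.
Implicit Types (x y : R) (n : int).

Definition perturbed_lift x : R := x + b - e * sin (w * x).
Local Notation F := perturbed_lift.
Local Notation T := (circle_map F).

Let w_gt1 : 1 < w.
Proof.
have : 4 <= pi *+ 2 :> R by rewrite mulr2n; have := @pi_ge2 R; lra.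
have : 1 <= k%:R :> R by rewrite ler1n.
by rewrite /w; nra.
Qed.

Let w_gt0 : 0 < w. Proof. by apply: lt_trans w_gt1. Qed.

Let w2_gt0 : 0 < 2 * w. Proof. exact: mulr_gt0. Qed.

Let wDint x n : w * (x + n%:~R) = w * x + (k%:Z * n)%:~R * (pi *+ 2).
Proof. by rewrite mulrDr intrM /w; ring. Qed.

Let sin_wDint x n : sin (w * (x + n%:~R)) = sin (w * x).
Proof. by rewrite wDint sinD2pi_int. Qed.

Let cos_wDint x n : cos (w * (x + n%:~R)) = cos (w * x).
Proof. by rewrite wDint cosD2pi_int. Qed.

(** Rotating by [b = p / k] shifts the phase [w * x] by [p] full periods. This is the reason for
    perturbing a rational rotation: only the sine term moves the phase. *)
Let cos_wDb x : cos (w * (x + b)) = cos (w * x).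
Proof.
have -> : w * (x + b) = w * x + p%:~R * (pi *+ 2); last exact: cosD2pi_int.
rewrite mulrDr /w /b; congr (_ + _).
by rewrite mulrAC mulrCA mulfV ?mulr1// pnatr_eq0 -lt0n.
Qed.

Lemma perturbed_lift_equivariant : int_equivariant F.
Proof. by move=> x n; rewrite /F sin_wDint; ring. Qed.

Let is_derive_sinw x : is_derive x 1 (fun y => sin (w * y)) (cos (w * x) * w).
Proof.
have dw : is_derive x 1 (fun y => w * y) w.
  by apply: is_derive_eq; rewrite [LHS]mulr1.
exact: (@is_derive1_comp R (@sin R)).
Qed.

Let is_derive_lift x : is_derive x 1 F (1 - e * w * cos (w * x)).
Proof.
have ds := is_derive_sinw x.
by apply: is_derive_eq; rewrite /GRing.scale/=; ring.
Qed.

Let smooth_lift : smooth F.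
Proof.
apply/smoothP => n.
have -> : F = (@id R + cst b) + cst (- e) * (@sin R \o (cst w * @id R)).
  by apply/funext => x; rewrite /F -mulNr.
have dcst c := @n_derivable_cst R n c; have did := @n_derivable_id R n.
have dsin := n_derivable_comp (@n_derivable_sin R n) (n_derivableM (dcst w) did).
exact: n_derivableD (n_derivableD did (dcst b)) (n_derivableM (dcst (- e)) dsin).
Qed.

(** The bound on [e * w] serves twice: the derivative of the lift stays at least 1/2, and
    [e * w - (e * w) ^+ 2] stays positive. *)
Hypotheses (e_gt0 : 0 < e) (ew_le : e * w <= 2^-1).

Let derive_lift_neq0 x : 1 - e * w * cos (w * x) != 0.
Proof.
apply: lt0r_neq0; rewrite subr_gt0.
apply: (@le_lt_trans _ _ 2^-1); last by lra.
apply: le_trans ew_le; rewrite ler_piMr ?cos_le1// mulr_ge0 ?ltW//.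
Qed.

Let lift_displacement x : `|F x - x| <= `|b| + e.
Proof.
rewrite /F (_ : _ - x = b - e * sin (w * x)); last by ring.
rewrite (le_trans (ler_normB _ _))// lerD2l normrM gtr0_norm//.
by rewrite ler_piMr ?sin_max// ltW.
Qed.

Let lift_increasing : {homo F : x y / x < y}.
Proof.
move=> x y xy; rewrite -subr_gt0.
have : `|e * (sin (w * y) - sin (w * x))| <= 2^-1 * (y - x).
  rewrite normrM gtr0_norm//.
  apply: (@le_trans _ _ (e * w * (y - x))); last first.
    by rewrite ler_wpM2r// subr_ge0 ltW.
  rewrite -mulrA ler_pM2l//.
  rewrite (le_trans (sin_lipschitz _ _))// -mulrBr normrM.
  by rewrite !gtr0_norm// subr_gt0.
by rewrite ler_norml /F => /andP[_]; lra.
Qed.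

Lemma smooth_diffeo_perturbed : smooth_diffeo T.
Proof.
have cF := is_derive_continuous is_derive_lift.
have [G [FK GK]] := bounded_displacement_can cF lift_increasing lift_displacement.
have sG : smooth G.
  apply/smoothP => n.
  apply: (is_derive_n_derivable_inverse FK GK cF derive_lift_neq0 is_derive_lift).
  have /smoothP/(_ n.+1)/n_derivable_is_derive[_] := smooth_lift.
  congr (n_derivable _ _); apply/funext => x.
  by rewrite derive1E; apply: derive_val; exact: is_derive_lift.
(* Continuity of the inverse is read off from its differentiability. *)
have /smoothP/(_ 1)/n_derivable_is_derive[/is_derive_continuous cG _] := sG.
exact: smooth_diffeo_circle_map perturbed_lift_equivariant FK GK cF cG smooth_lift sG.
Qed.

(** With the lifts [F] and [x + alpha] the difference is [b - alpha - e * sin (w * x)]. Its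
    derivatives of order [i <= r] bring a factor [w ^+ i], at most [w ^+ r] because [w > 1]. *)
Lemma Cr_norm_perturbed_le (r : nat) :
  exists2 f, lift_difference T (rotation alpha) f &
    (Cr_norm r f <= (`|b - alpha| + w ^+ r * e)%:E)%E.
Proof.
pose f (z : circle R) : R := (b - alpha) - e * sin (w * repr z).
have fE x : f (circle_proj x) = b - alpha - e * sin (w * x).
  by rewrite /f; have [n ->] := repr_circle_proj x; rewrite sin_wDint.
exists f.
  exists F, (fun x => x + alpha); split.
  - apply: is_lift_circle_map; first exact: perturbed_lift_equivariant.
    exact: is_derive_continuous is_derive_lift.
  - split=> [x|x]; last by rewrite /rotation -circle_projD.
    by apply: cvgD; [exact: cvg_id|exact: cvg_cst].
  - by move=> x; rewrite fE /F; ring.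
rewrite /Cr_norm.
have -> : f \o @circle_proj R =
    (fun x => (b - alpha) + (- e) * sin (w * x) + 0 * cos (w * x)).
  by apply/funext => x /=; rewrite fE mul0r addr0 mulNr.
apply: (big_ind (fun s => (s <= _)%E)) => [|x y xM yM|i _]; first exact: leNye.
  by rewrite ge_max xM.
apply: ge_ereal_sup => _ [x _ <-]; rewrite lee_fin.
rewrite (le_trans (derive1n_trig_le _ _ _ _ _ (ltW w_gt0)))// lerD2l.
rewrite normrN normr0 addr0 gtr0_norm// ler_wpM2r ?(ltW e_gt0)//.
by rewrite ler_weXn2l ?(ltW w_gt1)// -ltnS.
Qed.

(** Dividing by [2 * w] makes the derivative [sin (w * x) * cos (w * x)], which is bounded by 1. *)
Let test x : R := sin (w * x) ^+ 2 / (2 * w).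

Let testDint x n : test (x + n%:~R) = test x.
Proof. by rewrite /test sin_wDint. Qed.

Let is_derive_test x : is_derive x 1 test (sin (w * x) * cos (w * x)).
Proof.
have ds := is_derive_sinw x.
have -> : test = (fun y => sin (w * y)) * (fun y => sin (w * y)) * cst (2 * w)^-1.
  by apply/funext => y; rewrite /test expr2.
apply: is_derive_eq; rewrite /GRing.scale/=.
by rewrite /cst; field; exact: lt0r_neq0.
Qed.

Let test_ge0 x : 0 <= test x.
Proof. by rewrite /test divr_ge0 ?sqr_ge0// ltW. Qed.

Let test_le1 x : `|test x| <= 1.
Proof.
rewrite ger0_norm// /test ler_pdivrMr// mul1r.
rewrite sin2cos2 (@le_trans _ _ 1)//; first by rewrite gerBl sqr_ge0.
by have := w_gt1; lra.
Qed.

Let circle_test (z : circle R) : R := test (repr z).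

Let circle_testE x : circle_test (circle_proj x) = test x.
Proof.
by rewrite /circle_test; have [n ->] := repr_circle_proj x; rewrite testDint.
Qed.

Let measurable_circle_test : measurable_fun [set: circle R] circle_test.
Proof.
apply: continuous_circle_measurable; apply: circle_continuousP.
have -> : circle_test \o @circle_proj R = test by apply/funext => x /=.
exact: is_derive_continuous is_derive_test.
Qed.

Let integral_test :
  (\int[@circle_lebesgue R]_z (circle_test z)%:E = (4 * w)^-1%:E)%E.
Proof.
rewrite integral_circle_lebesgue//; last by move=> z; exact: test_ge0.
under eq_integral do rewrite circle_testE.
(* A primitive of [test], from [sin ^+ 2 = (1 - cos (2 w x)) / 2]; its oscillating part vanishes at
   0 and 1 because [sin w = 0]. *)
pose P x : R := x / (4 * w) - sin (w * x) * cos (w * x) / (4 * w ^+ 2).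
have dP x : is_derive x 1 P (test x).
  have dw : is_derive x 1 (fun y => w * y) w.
    by apply: is_derive_eq; rewrite [LHS]mulr1.
  have dc : is_derive x 1 (fun y => cos (w * y)) (- sin (w * x) * w).
    exact: (@is_derive1_comp R (@cos R)).
  have ds := is_derive_sinw x.
  have -> : P = (@id R * cst (4 * w)^-1 -
     (fun y => sin (w * y)) * (fun y => cos (w * y)) * cst (4 * w ^+ 2)^-1)%R.
    by apply/funext => y.
  apply: is_derive_eq; rewrite /GRing.scale/= /cst /test.
  have w0 : w != 0 by exact: lt0r_neq0.
  by rewrite !mulr0 [cos _ * (cos _ * w)]mulrA -expr2 cos2sin2; field.
have cP := is_derive_continuous dP.
rewrite (@continuous_FTC2 _ _ P)//.
- have := sin_wDint 0 1; rewrite add0r mulr1 mulr0 sin0 => s0.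
  by rewrite /P mulr1 s0 !mulr0 sin0 !mul0r !subr0 mul1r -EFinB subr0.
- exact/continuous_subspaceT/(is_derive_continuous is_derive_test).
- split=> [x _||]; first by case: (dP x).
    exact/cvg_at_right_filter/cP.
  exact/cvg_at_left_filter/cP.
- by move=> x _; rewrite derive1E; apply: derive_val; exact: dP.
Qed.

Let integral_test_invariant (mu : probability (circle R) R) :
  invariant_measure T mu -> (\int[mu]_z (circle_test z)%:E = 0)%E.
Proof.
(* [cos (w x)] is a Lyapunov function: along [T] it increases by at least a
   positive multiple of the test function, but its integral is invariant. *)
move=> muT; pose h (z : circle R) : R := cos (w * repr z).
have hE x : h (circle_proj x) = cos (w * x).
  by rewrite /h; have [n ->] := repr_circle_proj x; rewrite cos_wDint.
have ch : measurable_fun [set: circle R] h.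
  apply: continuous_circle_measurable; apply: circle_continuousP.
  have -> : h \o @circle_proj R = @cos R \o (fun x => w * x).
    by apply/funext => x /=.
  move=> x; apply: continuous_comp; last exact: continuous_cos.
  exact: mulrl_continuous.
have h1 z : `|h z| <= 1 by exact: cos_max.
have mT : measurable_fun [set: circle R] T.
  apply: measurable_circle_map; first exact: perturbed_lift_equivariant.
  exact: is_derive_continuous is_derive_lift.
(* Modulo periods [T] moves the phase [u = w * x] to [u - e * w * sin u], so [cos_flow_ge] applies
   with [e * w] for [e]; the factor [2 * w] undoes the normalisation of [test]. *)
pose c : R := (e * w - (e * w) ^+ 2) * (2 * w).
have c_gt0 : 0 < c.
  have ew_gt0 : 0 < e * w by exact: mulr_gt0.
  apply: mulr_gt0 => //; move: ew_gt0 ew_le.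
  by move: (e * w) => v; nra.
have hT z : h z + c * circle_test z <= h (T z).
  rewrite -[in h (T z)](circle_projK z) circle_mapE; last exact: perturbed_lift_equivariant.
  rewrite hE /F -addrA [b + _]addrC addrA cos_wDb mulrBr [w * (e * _)]mulrA [w * e]mulrC.
  apply: le_trans (cos_flow_ge _ _); rewrite /h lerD2l /c /circle_test /test.
  by rewrite -mulrA [2 * w * _]mulrC divfK// lt0r_neq0.
have ih := bounded_integrable mu ch h1.
have it : mu.-integrable setT (EFin \o circle_test).
  exact: bounded_integrable measurable_circle_test (fun z => test_le1 _).
have mhT : measurable_fun [set: circle R] (h \o T) by exact: measurableT_comp.
have ihT := bounded_integrable mu mhT (fun z => h1 (T z)).
have hf := integrable_fin_num measurableT ih.
have ict : mu.-integrable setT (fun z => (c%:E * (circle_test z)%:E)%E).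
  exact: integrableZl.
have : (\int[mu]_z ((h z)%:E + c%:E * (circle_test z)%:E) <= \int[mu]_z (h (T z))%:E)%E.
  apply: le_integral => //; first exact: integrableD.
  by move=> z _; rewrite -EFinM -EFinD lee_fin.
(* By invariance the finite integral of [h] cancels on both sides, leaving [c] times the integral of
   the test function at most 0. *)
rewrite (integral_invariant mT muT ch h1) integralD//.
rewrite -[leRHS]adde0 leeD2lE// integralZl// => ile.
apply/eqP; rewrite eq_le integral_ge0 ?andbT; last first.
  by move=> z _; rewrite lee_fin test_ge0.
by rewrite pmule_rle0 in ile.
Qed.

(** The function [circle_test] is admissible in the supremum; it integrates to [(4 * w)^-1] for
    Lebesgue measure and to 0 for [mu]. *)
Lemma W_norm_perturbed_ge (mu : probability (circle R) R) :
  invariant_measure T mu ->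
  ((4 * w)^-1%:E <= W_norm (measure_sub (@circle_lebesgue R) mu))%E.
Proof.
move=> muT; apply: ereal_sup_ubound; exists circle_test; last first.
  rewrite charge_integral_sub ?integral_test ?integral_test_invariant// ?sube0.
  - by rewrite gee0_abs// lee_fin invr_ge0 mulr_ge0// ltW.
  - exact: bounded_integrable measurable_circle_test (fun z => test_le1 _).
  - exact: bounded_integrable measurable_circle_test (fun z => test_le1 _).
split.
  apply: circle_fun_lipschitz => //.
  apply: (lipschitz_is_derive is_derive_test) => x.
  by rewrite normrM mulr_ile1 ?sin_max ?cos_max.
by apply: ge_ereal_sup => _ [z _ <-]; rewrite lee_fin test_le1.
Qed.

End perturbed_rotation.

(** * Choice of the parameters and conclusion *)

Unset Implicit Arguments.

Theorem proposition17 (R : realType) (alpha : R)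
    (alpha_irrational : irrational alpha)
    (alpha_type : (1 < diophantine_type alpha)%E)
    (r : nat) (gamma' : R) (gamma'_ge0 : 0 <= gamma')
    (gamma'_lt : (gamma'%:E < diophantine_type alpha)%E) :
  exists (delta : nat -> R) (T : nat -> circle R -> circle R),
    [/\ forall j, 0 < delta j,
        delta j @[j --> \oo] --> 0,
        forall j, smooth_diffeo (T j) &
        forall j,
          (exists2 f, lift_difference (T j) (rotation alpha) f &
             (Cr_norm r f <= (2 * delta j)%:E)%E) /\
          forall mu : probability (circle R) R, invariant_measure (T j) mu ->
            ((1 / 2 * delta j `^ (1 / (gamma' + 1)))%:E
               <= W_norm (measure_sub (@circle_lebesgue R) mu))%E].
Proof.
pose s := gamma' + 1.
have s1 : 1 <= s by rewrite lerDr.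
have s0 : 0 < s by rewrite (lt_le_trans ltr01).
have pi4 : 4 <= pi *+ 2 :> R by rewrite mulr2n; have := @pi_ge2 R; lra.
(* Here [q] is 4 pi, so that [2 * w j = k j * q] below; the tolerance [q ^ (- s)] is tuned to turn
   the approximation error into [delta j]. *)
pose q : R := 2 * (pi *+ 2).
have q8 : 8 <= q by rewrite /q; lra.
have q0 : 0 < q by rewrite (lt_le_trans _ q8).
have eta0 : 0 < q `^ (- s) by rewrite powR_gt0.
pose good j (kp : nat * int) := [/\ (j.+1 <= kp.1)%N, (0 < kp.1)%N &
  kp.1%:R `^ gamma' * `|kp.1%:R * alpha - kp.2%:~R| < q `^ (- s)].
have ex_good j : exists kp, good j kp.
  have [k [p [? ? ?]]] := diophantine_type_approx j.+1 gamma'_ge0 gamma'_lt eta0.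
  by exists (k, p).
have [kp goodkp] := choice ex_good.
pose k j := (kp j).1; pose p j := (kp j).2.
pose w j : R := (k j)%:R * (pi *+ 2).
(* This makes [delta j ^ (1 / s)] equal to [1 / (2 * w j)], whose half is the lower bound of
   [W_norm_perturbed_ge]. *)
pose delta j := (2 * w j) `^ (- s).
(* Small enough for two demands: [w ^+ r * e <= delta] for the norm estimate, and [e * w <= 1/2] for
   a diffeomorphism. *)
pose e j := delta j / (2 * w j ^+ r.+1).
have k_gt0 j : (0 < k j)%N by case: (goodkp j).
have k1 j : 1 <= (k j)%:R :> R by rewrite ler1n.
have w1 j : 1 <= w j by rewrite /w; have := k1 j; nra.
have w0 j : 0 < w j by rewrite (lt_le_trans ltr01).
have w2 j : 1 <= 2 * w j by have := w1 j; lra.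
have d0 j : 0 < delta j by rewrite powR_gt0 ?(lt_le_trans ltr01).
have dle j : delta j <= (2 * w j)^-1.
  rewrite -powR_inv1; last exact: le_trans (w2 j).
  by rewrite /delta ler_powR// lerN2.
have d1 j : delta j <= 1 by rewrite (le_trans (dle j))// invf_le1// (lt_le_trans ltr01).
have wr j : 1 <= w j ^+ r by rewrite exprn_ege1.
have e0 j : 0 < e j by rewrite divr_gt0// mulr_gt0// exprn_gt0.
have wre j : w j ^+ r * e j <= delta j.
  rewrite /e exprS (_ : _ * _ = delta j * (2 * w j)^-1); last first.
    by field; rewrite !lt0r_neq0// exprn_gt0.
  by rewrite ler_piMr ?(ltW (d0 j))// invf_le1// (lt_le_trans ltr01).
have ew j : e j * w j <= 2^-1.
  rewrite /e exprS (_ : _ * _ = 2^-1 * (delta j / w j ^+ r)); last first.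
    by field; rewrite !lt0r_neq0// exprn_gt0.
  by rewrite ler_piMr// ler_pdivrMr ?mul1r ?(le_trans (d1 j))// exprn_gt0.
have approx j : `|(p j)%:~R / (k j)%:R - alpha| <= delta j.
  have [_ _ kpd] := goodkp j; rewrite -/(k j) -/(p j) in kpd.
  have k0 : 0 < (k j)%:R :> R by rewrite ltr0n.
  rewrite distrC (_ : alpha - _ = ((k j)%:R * alpha - (p j)%:~R) / (k j)%:R); last first.
    by field; exact: lt0r_neq0.
  rewrite normrM normfV (gtr0_norm k0) ler_pdivrMr//.
  have kg0 : 0 < (k j)%:R `^ gamma' :> R by rewrite powR_gt0.
  rewrite -(ler_pM2l kg0) (le_trans (ltW kpd))//.
  have ks : (k j)%:R `^ s = (k j)%:R `^ gamma' * (k j)%:R :> R.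
    by rewrite powRD ?powRr1 ?(ltW k0)// gt_eqF// implybT.
  (* The tolerance is met with equality: [k ^ gamma' * (delta * k) = q ^ (- s)], because
     [k ^ s = k ^ gamma' * k]. *)
  rewrite le_eqVlt /delta /w [2 * _]mulrCA -/q (powRM _ (ltW k0) (ltW q0)).
  rewrite (powRN (k j)%:R) ks; apply/orP; left; apply/eqP.
  by field; rewrite !lt0r_neq0.
exists delta, (fun j => circle_map (perturbed_lift (k j) (p j) (e j))); split.
- exact: d0.
(* Convergence follows from [delta j <= 1 / (2 * w j)] and [2 * w j >= k j >= j + 1]. *)
- apply: (@squeeze_cvgr _ _ _ _ (fun=> 0) (fun j => j.+1%:R^-1)).
  + near=> j; rewrite ltW//= (le_trans (dle j))// lef_pV2 ?posrE ?(lt_le_trans ltr01 (w2 j))//.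
    apply: (@le_trans _ _ (k j)%:R).
      by rewrite ler_nat; case: (goodkp j).
    by rewrite /w; have := k1 j; nra.
  + exact: cvg_cst.
  + exact: cvg_harmonic.
- by move=> j; apply: smooth_diffeo_perturbed.
- move=> j; split.
    have [f fT fr] := Cr_norm_perturbed_le (p j) alpha (k_gt0 j) (e0 j) r.
    exists f => //; apply: (le_trans fr); rewrite lee_fin.
    (* One [delta j] pays for replacing [alpha] by [p / k], the other for the sine term. *)
    by rewrite [leRHS]mulr_natl [leRHS]mulr2n lerD ?approx ?wre.
  move=> mu muT.
  have := W_norm_perturbed_ge (k_gt0 j) (e0 j) (ew j) muT.
  apply: le_trans; rewrite lee_fin -/s /delta -powRrM.
  rewrite (_ : - s * (1 / s) = -1); last by field; exact: lt0r_neq0.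
  rewrite powR_inv1; last exact: le_trans (w2 j).
  by rewrite -/(w j) le_eqVlt; apply/orP; left; apply/eqP; field; exact: lt0r_neq0.
Unshelve. all: by end_near.
Qed.
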